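(* Let $(X,T)$ be a topological dynamical system. Then $(X,T)$ is $\overline{BF}$-continuous if and only if $(X,T)$ is $BF$-continuous.
   Context: A topological dynamical system $(X,T)$ is a compact metric space $X$ with metric $d$ together with a continuous map $T:X\to X$. For integers $0\le m<n$, $S_{n,m}$ is the group of permutations of $\{m,m+1,\dots,n-1\}$. For a real family $(a_{m,n})_{0\le m<n}$, $\limsup_{n-m\to+\infty}a_{m,n}=\lim_{N\to\infty}\sup\{a_{m,n}: n-m\ge N\}$ and $\liminf_{n-m\to+\infty}a_{m,n}=\lim_{N\to\infty}\inf\{a_{m,n}: n-m\ge N\}$. Define $$\overline{BF}(x,y)=\limsup_{n-m\to+\infty}\ \inf_{\sigma\in S_{n,m}}\frac1{n-m}\sum_{k=m}^{n-1}d(T^kx,T^{\sigma(k)}y),\qquad \underline{BF}(x,y)=\liminf_{n-m\to+\infty}\ \inf_{\sigma\in S_{n,m}}\frac1{n-m}\sum_{k=m}^{n-1}d(T^kx,T^{\sigma(k)}y).$$ $BF(x,y)$ exists if $\overline{BF}(x,y)=\underline{BF}(x,y)$, and then denotes the common value. $(X,T)$ is $\overline{BF}$-continuous if for every $x\in X$ and every $\varepsilon>0$ there is $\delta>0$ such that $d(x,y)<\delta$ implies $\overline{BF}(x,y)<\varepsilon$. $(X,T)$ is $BF$-continuous if for every $x\in X$ and every $\varepsilon>0$ there is $\delta>0$ such that whenever $d(x,y)<\delta$, $BF(x,y)$ exists and $BF(x,y)<\varepsilon$. *)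

(* Defs.v *)
From mathcomp Require Import all_boot all_order all_algebra fingroup perm.
From mathcomp Require Import all_classical all_reals all_analysis.

Set Implicit Arguments.
Unset Strict Implicit.
Unset Printing Implicit Defensive.

Import Order.TTheory GRing.Theory Num.Theory.

Local Open Scope classical_set_scope.
Local Open Scope ring_scope.

Section LimSupInf.
Context {R : realType}.
Implicit Type a : nat -> nat -> R.

Definition gap_ge (N : nat) : set (nat * nat) :=
  [set p | (p.1 < p.2)%N /\ (N <= p.2 - p.1)%N].

(* The limits are taken in the extended reals, where they always exist. *)
Definition limsup_gap a : \bar R :=
  limn (fun N => ereal_sup [set (a p.1 p.2)%:E | p in gap_ge N]).

Definition liminf_gap a : \bar R :=
  limn (fun N => ereal_inf [set (a p.1 p.2)%:E | p in gap_ge N]).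

End LimSupInf.

(* The permutations of {m, ..., n-1}, represented as the permutations of
   {0, ..., n-1} that fix every i < m. *)
Definition perm_range (m n : nat) : {set {perm 'I_n}} :=
  Sym [set i : 'I_n | (m <= i)%N].

Section BFpseudometric.
Context {R : realType} {X : metricType R}.
Variable T : X -> X.
Implicit Types x y : X.

Definition perm_avg x y (m n : nat) (s : {perm 'I_n}) : R :=
  (n - m)%:R^-1 *
    \sum_(k < n | (m <= k)%N) mdist (iter k T x) (iter (s k) T y).

Definition min_avg x y (m n : nat) : R :=
  inf [set perm_avg x y m s | s in [set s | s \in perm_range m n]].

Definition BFsup x y : \bar R := limsup_gap (min_avg x y).

Definition BFinf x y : \bar R := liminf_gap (min_avg x y).

Definition BF_exists x y : Prop := BFsup x y = BFinf x y.

(* Meaningful only under BF_exists x y. *)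
Definition BF x y : \bar R := BFsup x y.

Definition BFsup_continuous : Prop :=
  forall x (e : R), 0 < e -> exists2 delta : R, 0 < delta &
    forall y, mdist x y < delta -> (BFsup x y < e%:E)%E.

Definition BF_continuous : Prop :=
  forall x (e : R), 0 < e -> exists2 delta : R, 0 < delta &
    forall y, mdist x y < delta -> BF_exists x y /\ (BF x y < e%:E)%E.

End BFpseudometric.

(* Main.v *)
(** If z is a limit of points T^k x, then BFsup x (T^k x) = 0 and
BFsup-continuity at z give BFsup x z = 0, so any two points of the orbit closure
of x are cheaply matched on all long windows starting at 0.  By compactness the
length of such a window is bounded, and concatenating these windows shows that
all long windows of equal length of the orbit of x are uniformly cheaply matched
with each other, and likewise for y.  The optimal average cost between x and y
over [m, n) thus depends, up to a small error, only on n - m; as the total cost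
is subadditive under concatenation, the upper limit is at most any value of the
average over a long window, hence at most the lower limit. *)

Require Import Defs.
From mathcomp Require Import all_boot all_order all_algebra.
From mathcomp Require Import fingroup perm zify lra.
From mathcomp Require Import all_classical all_reals all_analysis.

Import Order.TTheory GRing.Theory Num.Theory.

Local Open Scope classical_set_scope.
Local Open Scope ring_scope.

(** * Permutations of {0, ..., n-1} as functions on [nat] *)

Lemma perm_map_iota (f : nat -> nat) n :
  {in iota 0 n &, injective f} -> (forall k, (k < n)%N -> (f k < n)%N) ->
  perm_eq (map f (iota 0 n)) (iota 0 n).
Proof.
move=> finj flt.
have funiq : uniq (map f (iota 0 n)) by rewrite map_inj_in_uniq ?iota_uniq.
have fsub : {subset map f (iota 0 n) <= iota 0 n}.
  by move=> _ /mapP[k + ->]; rewrite !mem_iota !add0n /= => /flt.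
apply: uniq_perm => //; first exact: iota_uniq.
by have [] := uniq_min_size funiq fsub _; rewrite ?size_map.
Qed.

Lemma natr_mul_large {R : realType} (c e : R) : 0 < e ->
  exists N, forall n, (N <= n)%N -> c < n%:R * e.
Proof.
move=> e0; exists (Num.trunc (c / e)).+1 => n Nn.
by rewrite -ltr_pdivrMr// (lt_le_trans (truncnS_gt _))// ler_nat.
Qed.

Section Permuted.
Context {f : nat -> nat} {n : nat}.
Hypothesis fP : perm_eq (map f (iota 0 n)) (iota 0 n).

Lemma perm_map_iota_lt k : (k < n)%N -> (f k < n)%N.
Proof.
move=> kn; have := perm_mem fP (f k).
by rewrite map_f mem_iota ?add0n.
Qed.

Lemma index_map_iotaK k : (k < n)%N -> index (f k) (map f (iota 0 n)) = k.
Proof.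
move=> kn; have fk : f k = nth 0%N (map f (iota 0 n)) k.
  by rewrite (nth_map 0%N) ?size_iota// nth_iota.
by rewrite fk index_uniq ?size_map ?size_iota// (perm_uniq fP) iota_uniq.
Qed.

End Permuted.

(** * Matchings of orbit segments *)

Section Matching.
Context {R : realType} {X : metricType R}.
Implicit Types (T : X -> X) (u v w x y : X) (c d : R).

(* [f] permutes {0, ..., n-1}; [c] bounds the total, not the average, cost. *)
Definition matched T u v (n : nat) c : Prop :=
  exists2 f : nat -> nat, perm_eq (map f (iota 0 n)) (iota 0 n) &
    \sum_(k <- iota 0 n) mdist (iter k T u) (iter (f k) T v) <= c.

Lemma matched_le {T u v n c} d :
  c <= d -> matched T u v n c -> matched T u v n d.
Proof. by move=> cd [f fP fc]; exists f => //; exact: le_trans cd. Qed.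

Lemma matched_id T u v n :
  matched T u v n (\sum_(k <- iota 0 n) mdist (iter k T u) (iter k T v)).
Proof. by exists id => //; rewrite map_id. Qed.

Lemma matched_sym {T u v n c} : matched T u v n c -> matched T v u n c.
Proof.
(* [g] inverts [f] on {0, ..., n-1}: the position of a value is its preimage. *)
move=> [f fP fc]; pose g j := index j (map f (iota 0 n)).
exists g.
  apply: perm_trans (perm_map g _) _; first by rewrite perm_sym; exact: fP.
  rewrite -map_comp (@eq_in_map _ _ _ id _).1 ?map_id// => k.
  by rewrite mem_iota add0n /= /g => /(index_map_iotaK fP _).
apply: le_trans fc; rewrite -(perm_big _ fP) big_map /=.
rewrite !big_seq; apply: ler_sum => k; rewrite mem_iota add0n /= => kn.
by rewrite /g (index_map_iotaK fP _ kn) metric_sym.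
Qed.

Lemma matched_trans {T u v w n c d} :
  matched T u v n c -> matched T v w n d -> matched T u w n (c + d).
Proof.
move=> [f fP fc] [g gP gd]; exists (g \o f).
  by rewrite map_comp; apply: perm_trans gP; exact: perm_map.
move: gd; rewrite -(perm_big _ fP) big_map => gd.
apply: le_trans (lerD fc gd); rewrite -big_split /=.
by apply: ler_sum => k _; exact: metric_triangle.
Qed.

Lemma matched_cat {T u v n p c d} :
  matched T u v n c -> matched T (iter n T u) (iter n T v) p d ->
  matched T u v (n + p) (c + d).
Proof.
move=> [f fP fc] [g gP gd].
pose h k := if (k < n)%N then f k else (n + g (k - n))%N.
have hl : {in iota 0 n, h =1 f} by move=> k; rewrite mem_iota /h /= => ->.
have hr k : h (n + k)%N = (n + g k)%N by rewrite /h ltnNge leq_addr addKn.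
have iotaE : iota n p = map (addn n) (iota 0 p) by rewrite -iotaDl addn0.
exists h.
  rewrite iotaD add0n map_cat; apply: perm_cat.
    by rewrite (@eq_in_map _ _ _ f _).1.
  rewrite iotaE -map_comp (@eq_map _ _ _ (addn n \o g)) // map_comp.
  exact: perm_map.
rewrite iotaD big_cat add0n /=; apply: lerD.
  apply: le_trans fc; rewrite !big_seq; apply: ler_sum => k kn.
  by rewrite hl.
rewrite iotaE big_map; apply: le_trans gd; apply: ler_sum => k _.
by rewrite hr !(addnC n) !iterD.
Qed.

Section Bounded.
Variable D : R.
Hypothesis bndD : forall a b : X, mdist a b <= D.

(** The two segments share all but one point each, so the cost is bounded independently of [n]. *)
Lemma matched_shift T u n : matched T u (T u) n D.
Proof.
have D0 : 0 <= D by apply: le_trans (bndD u u); exact: mdist_ge0.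
case: n => [|n]; first by exists id; rewrite //= big_nil.
(* Cyclic shift of a window of length [n.+1]: time k+1 of [u] meets time k of [T u] at cost 0, and
   only time 0 of [u] is matched at a positive cost. *)
exists (fun k => if k is k'.+1 then k' else n).
  rewrite [in X in perm_eq X]/= (iotaDl 1 0) -map_comp map_id.
  by rewrite -addn1 iotaD cats1 perm_sym perm_rcons.
rewrite /= big_cons (iotaDl 1 0) big_map big1 ?addr0 ?bndD// => k _.
by rewrite -iterSr mdistxx.
Qed.

Lemma matched_iter T u k n : matched T u (iter k T u) n (k%:R * D).
Proof.
elim: k => [|k IH].
  apply: matched_le (matched_id T u u n).
  by rewrite mul0r big1// => i _; rewrite mdistxx.
apply: matched_le (matched_trans IH (matched_shift T (iter k T u) n)).
by rewrite -[in leRHS]addn1 natrD mulrDl mul1r.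
Qed.

(* Greedy decomposition of [0, L) into cheaply matched blocks, the incomplete
   last block being matched trivially at cost at most N * D. *)
Lemma matched_blocks {T u v N c} : 0 <= c ->
  (forall i, exists2 n, (0 < n <= N)%N &
    matched T (iter i T u) (iter i T v) n (n%:R * c)) ->
  forall L, matched T u v L (L%:R * c + N%:R * D).
Proof.
move=> c0 uv L; have [L' leL] := ubnP L.
have D0 : 0 <= D by apply: le_trans (bndD u u); exact: mdist_ge0.
elim: L' => // L' IH in L leL u v uv *.
have [LN|NL] := leqP L N.
  apply: matched_le (matched_id T u v L).
  apply: (@le_trans _ _ (L%:R * D)).
    apply: le_trans (ler_sum _ (fun k _ => bndD _ _)) _.
    by rewrite big_const_seq iter_addr_0 count_predT size_iota mulr_natl.
  by rewrite -[leLHS]add0r lerD// ?mulr_ge0// ler_wpM2r// ler_nat.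
have [n /andP[n0 nN] mn] := uv 0%N.
have nL : (n <= L)%N by lia.
rewrite -(subnKC nL); apply: matched_le (matched_cat mn (IH (L - n)%N _ _ _ _)).
- by rewrite natrD; lra.
- by lia.
- by move=> i; rewrite -!iterD.
Qed.

End Bounded.

End Matching.

(** * Optimal averages versus matchings *)

Section Averages.
Context {R : realType} {X : metricType R}.
Variable T : X -> X.
Implicit Types (x y : X) (c : R) (m n : nat).

Lemma perm_avgE x y m n (s : {perm 'I_n}) (g : nat -> nat) :
  (forall i : 'I_n, g i = s i) ->
  perm_avg T x y m s = (n - m)%:R^-1 *
    \sum_(k <- iota 0 (n - m))
      mdist (iter k T (iter m T x)) (iter (g (m + k)%N) T y).
Proof.
move=> gs; rewrite /perm_avg; congr (_ * _).
under eq_bigr => k _ do rewrite -gs.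
rewrite -(big_mkord (fun k => (m <= k)%N)
  (fun k => mdist (iter k T x) (iter (g k) T y))).
rewrite -(big_nat_widenl m 0 n xpredT)// /index_iota.
rewrite -{1}(addn0 m) iotaDl big_map; apply: eq_bigr => k _.
by rewrite addnC iterD.
Qed.

Let min_avg_set_nonempty x y m n :
  [set perm_avg T x y m s | s in [set s | s \in perm_range m n]] !=set0.
Proof.
exists (perm_avg T x y m (1%g : {perm 'I_n})).
by exists 1%g; rewrite //= inE perm_on1.
Qed.

Let perm_avg_ge0 x y m n (s : {perm 'I_n}) : 0 <= perm_avg T x y m s.
Proof.
by rewrite mulr_ge0 ?invr_ge0//; apply: sumr_ge0 => k _; exact: mdist_ge0.
Qed.

Lemma min_avg_ge0 x y m n : 0 <= min_avg T x y m n.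
Proof.
apply: lb_le_inf => [|_ [s _ <-]]; first exact: min_avg_set_nonempty.
exact: perm_avg_ge0.
Qed.

(** The strict inequality provides a permutation of average below [c], whether or not the infimum is
    known to be attained. *)
Lemma min_avg_lt {x y m n c} : (m < n)%N -> min_avg T x y m n < c ->
  matched T (iter m T x) (iter m T y) (n - m) ((n - m)%:R * c).
Proof.
move=> mn /inf_lt[|_ [s /= + <-]].
  exact: min_avg_set_nonempty.
rewrite inE => sP sc.
pose g k := if insub k is Some i then val (s i) else k.
have gs (i : 'I_n) : g i = s i by rewrite /g valK.
have gE k (kn : (k < n)%N) : g k = s (Ordinal kn) by rewrite -gs.
have mg k : (m + k < n)%N -> (m <= g (m + k) < n)%N.
  move=> kn; rewrite gE ltn_ord andbT.
  by have := perm_closed (Ordinal kn) sP; rewrite !inE /= leq_addr.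
exists (fun k => g (m + k) - m)%N.
  apply: perm_map_iota => [k l|k kn]; last first.
    by have := mg k; lia.
  rewrite !mem_iota !add0n /= => kn ln gkl.
  have kn' : (m + k < n)%N by lia.
  have ln' : (m + l < n)%N by lia.
  have /andP[gk _] := mg _ kn'; have /andP[gl _] := mg _ ln'.
  have : g (m + k)%N = g (m + l)%N by rewrite -(subnK gk) gkl subnK.
  by rewrite !gE => /val_inj/perm_inj[] /addnI.
rewrite -ler_pdivrMl ?ltr0n ?subn_gt0//; move/ltW: sc; apply: le_trans.
rewrite (perm_avgE x y m n s g gs) ler_wpM2l//.
rewrite !big_seq; apply: ler_sum => k; rewrite mem_iota add0n /= => kn.
have /andP[gk _] : (m <= g (m + k) < n)%N by apply: mg; lia.
by rewrite -(iterD (g (m + k) - m)%N) subnK.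
Qed.

Lemma min_avg_le {x y m n c} : (m < n)%N ->
  matched T (iter m T x) (iter m T y) (n - m) ((n - m)%:R * c) ->
  min_avg T x y m n <= c.
Proof.
move=> mn [f fP fc].
(* Translate [f] to {m, ..., n-1} and fix everything below [m], as [perm_range] demands. *)
pose h k := if (k < m)%N then k else (m + f (k - m))%N.
have hlt (i : 'I_n) : (h i < n)%N.
  rewrite /h; case: (ltnP i m) => mi; first exact: ltn_ord.
  rewrite -ltn_subRL; apply: (perm_map_iota_lt fP).
  by rewrite ltn_sub2r// (leq_ltn_trans mi).
have hinj : injective (fun i => Ordinal (hlt i)).
  move=> i j [] hij; apply: val_inj => /=; move: hij; rewrite /h.
  case: ltnP => mi; case: ltnP => mj //; [lia|lia|] => /addnI fij.
  rewrite -(subnK mi) -(subnK mj); congr (_ + _)%N.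
  have lt_sub (l : 'I_n) : (m <= l)%N -> (l - m < n - m)%N.
    by move=> ml; rewrite ltn_sub2r// (leq_ltn_trans ml).
  rewrite -(index_map_iotaK fP _ (lt_sub i mi)) fij.
  exact: (index_map_iotaK fP _ (lt_sub j mj)).
have gs (i : 'I_n) : h i = perm hinj i by rewrite permE.
apply: (@le_trans _ _ (perm_avg T x y m (perm hinj))).
  apply: ge_inf; first by exists 0 => _ [s _ <-]; exact: perm_avg_ge0.
  exists (perm hinj) => //=; rewrite inE.
  apply/fintype.subsetP => i; rewrite !inE.
  apply: contraNT; rewrite -ltnNge => im; apply/eqP/val_inj.
  by rewrite /= permE /= /h im.
rewrite (perm_avgE x y m n _ h gs) ler_pdivrMl ?ltr0n ?subn_gt0//.
apply: le_trans fc; apply: ler_sum => k _.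
by rewrite /h ltnNge leq_addr/= addKn addnC iterD.
Qed.

End Averages.

(** * Upper and lower limits over long windows *)

Section Gaps.
Context {R : realType}.
Implicit Type a : nat -> nat -> R.

Let sup_gap_homo a :
  {homo (fun N => ereal_sup [set (a p.1 p.2)%:E | p in gap_ge N]) :
    n m / (n <= m)%N >-> (m <= n)%E}.
Proof.
move=> n m nm; apply: ereal_sup_le => _ [p [p12 mp] <-].
by exists p => //; split => //; exact: leq_trans mp.
Qed.

Let inf_gap_homo a :
  {homo (fun N => ereal_inf [set (a p.1 p.2)%:E | p in gap_ge N]) :
    n m / (n <= m)%N >-> (n <= m)%E}.
Proof.
move=> n m nm; apply: ereal_inf_le_tmp => _ [p [p12 mp] <-].
by exists p => //; split => //; exact: leq_trans mp.
Qed.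

Lemma limsup_gap_lt a (e : \bar R) : (limsup_gap a < e)%E ->
  exists N, forall m n, (m < n)%N -> (N <= n - m)%N -> ((a m n)%:E < e)%E.
Proof.
rewrite /limsup_gap (cvg_lim _ (ereal_nonincreasing_cvgn (sup_gap_homo a)))//.
move=> /ereal_inf_lt[_ [N _ <-] Ne]; exists N => m n mn Nmn.
by apply: le_lt_trans Ne; apply: ereal_sup_ubound; exists (m, n).
Qed.

Lemma limsup_gap_le a N (e : \bar R) :
  (forall m n, (m < n)%N -> (N <= n - m)%N -> ((a m n)%:E <= e)%E) ->
  (limsup_gap a <= e)%E.
Proof.
move=> ae.
rewrite /limsup_gap (cvg_lim _ (ereal_nonincreasing_cvgn (sup_gap_homo a)))//.
apply: ge_ereal_inf; eexists; first by exists N.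
by apply: ge_ereal_sup => _ [[m n] [/= mn Nmn] <-]; exact: ae.
Qed.

Lemma liminf_gap_ge a N (e : \bar R) :
  (forall m n, (m < n)%N -> (N <= n - m)%N -> (e <= (a m n)%:E)%E) ->
  (e <= liminf_gap a)%E.
Proof.
move=> ae.
rewrite /liminf_gap (cvg_lim _ (ereal_nondecreasing_cvgn (inf_gap_homo a)))//.
apply: le_ereal_sup_tmp; eexists; first by exists N.
by apply: le_ereal_inf_tmp => _ [[m n] [/= mn Nmn] <-]; exact: ae.
Qed.

Lemma liminf_le_limsup_gap a : (liminf_gap a <= limsup_gap a)%E.
Proof.
apply: lee_lim.
- exact: cvgP (ereal_nondecreasing_cvgn (inf_gap_homo a)).
- exact: cvgP (ereal_nonincreasing_cvgn (sup_gap_homo a)).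
apply: nearW => N; apply: (@le_trans _ _ (a 0%N N.+1)%:E).
  by apply: ereal_inf_lbound; exists (0%N, N.+1) => //; split => //=; lia.
by apply: ereal_sup_ubound; exists (0%N, N.+1) => //; split => //=; lia.
Qed.

(** Each long window bounds the upper limit by its own value plus [e], so the upper limit minus [e]
    is at most the lower limit. The threshold [N'] may depend on the window. *)
Lemma limsup_liminf_gap_eq a :
  (forall e, 0 < e -> exists N, forall m n, (m < n)%N -> (N <= n - m)%N ->
    exists N', forall m' n', (m' < n')%N -> (N' <= n' - m')%N ->
      a m' n' <= a m n + e) ->
  limsup_gap a = liminf_gap a.
Proof.
move=> ae; apply/eqP; rewrite eq_le liminf_le_limsup_gap andbT.
apply/lee_addgt0Pr => e /ae[N aN]; rewrite -leeBlDr//.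
apply: (liminf_gap_ge _ N) => m n mn Nmn; rewrite leeBlDr//.
have [N' aN'] := aN _ _ mn Nmn.
by apply: (limsup_gap_le _ N') => m' n' mn' Nmn'; rewrite -EFinD lee_fin aN'.
Qed.

End Gaps.

(** * Compactness: bounded diameter and bounded matching lengths *)

Section Compactness.
Context {R : realType} {X : metricType R}.
Implicit Types (T : X -> X) (x y z w : X).

Lemma near_mdist z (e : R) : 0 < e -> \forall a \near z, mdist z a < e.
Proof.
move=> e0; have := nbhsx_ballx z e e0.
by rewrite ballEmdist.
Qed.

Lemma compact_mdist_bounded : compact [set: X] ->
  exists D : R, forall a b : X, mdist a b <= D.
Proof.
move=> cptX; have /compact_near_coveringP cov := compact_setX cptX cptX.
have [|N _ /(_ N (leqnn N)) ND] :=
  cov nat \oo (fun N p => mdist p.1 p.2 <= N%:R) _.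
  move=> [z w] _.
  (* Moving both points by less than 1 changes their distance by less than 2. *)
  exists ([set p : X * X | mdist z p.1 < 1 /\ mdist w p.2 < 1],
          [set N | (Num.trunc (2 + mdist z w)).+1 <= N]%N) => /=.
    split; last by exists (Num.trunc (2 + mdist z w)).+1.
    exists ([set a | mdist z a < 1], [set b | mdist w b < 1]) => //=.
    by split; exact: near_mdist.
  move=> [[a b] N] /= [[za wb] zwN].
  have : 2 + mdist z w < N%:R.
    by apply: (lt_le_trans (truncnS_gt _)); rewrite ler_nat.
  have := metric_triangle a z b; have := metric_triangle z w b.
  rewrite (metric_sym a z); lra.
by exists N%:R => a b; exact: (ND (a, b)).
Qed.

Lemma iter_continuous {T} k : continuous T -> continuous (iter k T).
Proof.
move=> cT; elim: k => [|k IH] z; first exact: cvg_id.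
by apply: continuous_comp; [exact: IH|exact: cT].
Qed.

Lemma near_matched {T} z n (e : R) : continuous T -> 0 < e ->
  \forall a \near z, matched T z a n (n%:R * e).
Proof.
move=> cT e0.
have nearT : \forall a \near z, forall k, (k < n)%N ->
    mdist (iter k T z) (iter k T a) < e.
  elim: n => [|n IH]; first by apply: nearW.
  have := iter_continuous n cT z _ (near_mdist (iter n T z) e e0).
  rewrite nbhs_simpl /= => IHn; near=> a => k; rewrite ltnS leq_eqVlt.
  case/predU1P => [->|]; first by near: a.
  by move: k; near: a.
apply: filterS nearT => a za; apply: matched_le (matched_id T z a n).
have -> : n%:R * e = \sum_(k <- iota 0 n) e.
  by rewrite big_const_seq iter_addr_0 count_predT size_iota mulr_natl.
rewrite !big_seq; apply: ler_sum => k; rewrite mem_iota add0n /= => kn.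
exact/ltW/za.
Unshelve. all: by end_near.
Qed.

(** A length that works for (z, w) works for all nearby pairs: each perturbed endpoint adds [e] to
    the average cost, whence [3 * e]. Finitely many such neighbourhoods cover K x K. *)
Lemma matched_uniform_length {T} (K : set X) (e : R) :
  compact K -> continuous T -> 0 < e ->
  (forall z w, K z -> K w ->
    exists2 n, (0 < n)%N & matched T z w n (n%:R * e)) ->
  exists N, forall z w, K z -> K w ->
    exists2 n, (0 < n <= N)%N & matched T z w n (n%:R * (3 * e)).
Proof.
move=> cptK cT e0 KK.
have /compact_near_coveringP cov := compact_setX cptK cptK.
have [|N _ /(_ N (leqnn N)) KN] := cov nat \oo (fun N p =>
  exists2 n, (0 < n <= N)%N & matched T p.1 p.2 n (n%:R * (3 * e))) _.
  move=> [z w] [/= Kz Kw]; have [n n0 zw] := KK _ _ Kz Kw.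
  exists ([set p : X * X | matched T z p.1 n (n%:R * e) /\
                           matched T w p.2 n (n%:R * e)],
          [set N | n <= N]%N) => /=.
    split; last by exists n.
    exists ([set a | matched T z a n (n%:R * e)],
            [set b | matched T w b n (n%:R * e)]) => //=.
    by split; exact: near_matched.
  move=> [[a b] N] /= [[za wb] nN]; exists n; first by rewrite n0.
  apply: matched_le (matched_trans (matched_trans (matched_sym za) zw) wb).
  lra.
by exists N => z w Kz Kw; exact: (KN (z, w)).
Qed.

End Compactness.

(** * Consequences of [BFsup]-continuity *)

Section BFsupContinuous.
Context {R : realType} {X : metricType R}.
Variables (T : X -> X) (D : R).
Hypotheses (cptX : compact [set: X]) (contT : continuous T).
Hypothesis bndD : forall a b : X, mdist a b <= D.
Hypothesis contBF : BFsup_continuous T.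
Implicit Types (x y z w : X) (e : R).

(** Continuity at [z] cheaply matches [z] with some T^k x near it. Passing from [x] to T^k x costs
    at most [k%:R * D] in total, negligible on long windows. *)
Lemma matched_orbit_closure x z e :
  0 < e -> closure (range (fun k => iter k T x)) z ->
  exists N, forall n, (N <= n)%N -> matched T x z n (n%:R * e).
Proof.
move=> e0 clz; have [delta d0 BFz] := contBF z (e / 2) ltac:(lra).
have [_ [[k _ <-] /= /BFz]] := clz _ (near_mdist z delta d0).
move=> /limsup_gap_lt[N zN].
have [M kM] := natr_mul_large (k%:R * D) (e / 2) ltac:(lra).
(* The 1 keeps the window nonempty, as [min_avg_lt] requires. *)
exists (maxn 1 (maxn N M)) => n Nn.
have n0 : (0 < n)%N by lia.
have /(min_avg_lt T n0) : min_avg T z (iter k T x) 0 n < e / 2.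
  by rewrite -lte_fin; apply: zN => //; lia.
rewrite subn0 /= => /matched_sym zk.
apply: matched_le (matched_trans (matched_iter D bndD T x k n) zk).
by have := kM n ltac:(lia); lra.
Qed.

Lemma matched_orbit_uniform x e : 0 < e ->
  exists N, forall i j n, (N <= n)%N ->
    matched T (iter i T x) (iter j T x) n (n%:R * e).
Proof.
move=> e0; pose K := closure (range (fun k => iter k T x)).
have e8 : 0 < e / 8 by lra.
have cptK : compact K by exact: subclosed_compact (@closed_closure _ _) cptX _.
(* Points of [K] are matched through [x], at [e / 8] for each half. Blocks then cost [3 * (e / 4)]
   on average, leaving [e / 4] for the incomplete last block. *)
have [z w Kz Kw|N KN] := matched_uniform_length K (e / 4) cptK contT ltac:(lra).
  have [N1 h1] := matched_orbit_closure x z _ e8 Kz.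
  have [N2 h2] := matched_orbit_closure x w _ e8 Kw.
  exists (maxn 1 (maxn N1 N2)); first lia.
  apply: matched_le (matched_trans (matched_sym (h1 _ _)) (h2 _ _)); [lra| |];
    lia.
have Kx i : K (iter i T x) by apply: subset_closure; exists i.
have [M NM] := natr_mul_large (N%:R * D) (e / 4) ltac:(lra).
exists M => i j n Mn.
apply: matched_le (matched_blocks D bndD (N := N) (c := 3 * (e / 4)) _ _ n).
- by have := NM n Mn; lra.
- lra.
- by move=> k; rewrite -!iterD; exact: KN.
Qed.

Lemma BF_exists_of_continuous x y : BF_exists T x y.
Proof.
apply: limsup_liminf_gap_eq => e e0.
have e8 : 0 < e / 8 by lra.
have [Nx hx] := matched_orbit_uniform x _ e8.
have [Ny hy] := matched_orbit_uniform y _ e8.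
exists (maxn Nx Ny) => m n mn Nmn.
set L := (n - m)%N; set v := min_avg T x y m n.
have L0 : (0 < L)%N by rewrite /L; lia.
have v0 : 0 <= v by exact: min_avg_ge0.
(* The extra [e / 8] makes the inequality strict for [min_avg_lt]. *)
have mL : matched T (iter m T x) (iter m T y) L (L%:R * (v + e / 8)).
  by apply: min_avg_lt => //; rewrite -/v; lra.
(* Go from time i+j to time [m] along the orbit of [x], cross to [y] by [mL], and return to time i+j
   along the orbit of [y]: three errors of [e / 8]. *)
have block i j : matched T (iter i T (iter j T x)) (iter i T (iter j T y)) L
    (L%:R * (v + e / 2)).
  rewrite -!iterD.
  have xm := hx (i + j)%N m L ltac:(lia).
  have my := hy m (i + j)%N L ltac:(lia).
  apply: matched_le (matched_trans (matched_trans xm mL) my).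
  rewrite -!mulrDr ler_wpM2l//; lra.
have [M LM] := natr_mul_large (L%:R * D) (e / 2) ltac:(lra).
exists M => m' n' mn' Mmn'; apply: min_avg_le => //.
apply: matched_le (matched_blocks D bndD (N := L) (c := v + e / 2) _ _ _).
- by have := LM _ Mmn'; lra.
- lra.
- by move=> i; exists L; rewrite ?L0 ?leqnn.
Qed.

End BFsupContinuous.

Theorem theorem6p7 (R : realType) (X : metricType R) (T : X -> X)
  (cptX : compact [set: X]) (contT : continuous T) :
  BFsup_continuous T <-> BF_continuous T.
Proof.
(* [BF] is [BFsup] by definition, so the same [delta] serves in both directions. *)
split=> [contBF|contBF] x e e0; have [delta d0 xd] := contBF x e e0;
  exists delta => // y /xd; last by case.
have [D bndD] := compact_mdist_bounded cptX.
by split => //; exact: (BF_exists_of_continuous T D cptX contT bndD contBF).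
Qed.
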